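(* Let $\mathbb{F}$ be a field of characteristic $2$ and $((\mathfrak{g},[2]),\mathscr{D})$ a ResLieDer pair over $\mathbb{F}$. If $((\tilde\mu_t,\tilde\sigma_t),\tilde{\mathscr{D}}_t)$ and $((\mu_t,\sigma_t),\mathscr{D}_t)$ are two equivalent 1-parameter formal deformations of $((\mathfrak{g},[2]),\mathscr{D})$, then their infinitesimals $((\tilde\mu_1,\tilde\sigma_1),\tilde{\mathscr{D}}_1)$ and $((\mu_1,\sigma_1),\mathscr{D}_1)$ are in the same cohomology class in $H^2_{\mathrm{ResLD}}(\mathfrak{g};\mathfrak{g})$.
   Context: Over a field $\mathbb{F}$ of characteristic $2$: a restricted Lie algebra $(\mathfrak{g},[2])$ is a Lie algebra with a map $x\mapsto x^{[2]}$ such that $[x^{[2]},y]_{\mathfrak{g}}=[x,[x,y]_{\mathfrak{g}}]_{\mathfrak{g}}$, $(ax)^{[2]}=a^2x^{[2]}$, $(x+y)^{[2]}=x^{[2]}+y^{[2]}+[x,y]_{\mathfrak{g}}$. A ResLieDer pair $((\mathfrak{g},[2]),\mathscr{D})$ is a restricted Lie algebra with a linear derivation $\mathscr{D}$ satisfying $\mathscr{D}(x^{[2]})=[x,\mathscr{D}(x)]_{\mathfrak{g}}$. Formal deformation: $\mu_t=\sum_{i\ge0}\mu_it^i$, $\sigma_t=\sum_{i\ge0}\sigma_it^i$, $\mathscr{D}_t=\sum_{i\ge0}\mathscr{D}_it^i$, where $\mu_i:\wedge^2\mathfrak{g}\to\mathfrak{g}$ are alternating bilinear, $\sigma_i:\mathfrak{g}\to\mathfrak{g}$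 are maps, $\mathscr{D}_i:\mathfrak{g}\to\mathfrak{g}$ are linear, with $((\mu_0,\sigma_0),\mathscr{D}_0)=(([\cdot,\cdot]_{\mathfrak{g}},[2]),\mathscr{D})$. $((\mu_t,\sigma_t),\mathscr{D}_t)$ is a 1-parameter formal deformation of $((\mathfrak{g},[2]),\mathscr{D})$ if it endows the $\mathbb{F}[[t]]$-module $\mathfrak{g}[[t]]$ with a ResLieDer pair structure; here $\mu_t,\mathscr{D}_t$ are extended $\mathbb{F}[[t]]$-(bi)linearly and $\sigma_t$ is extended by $\sigma_t(\sum_i x_it^i)=\sum_i\sigma_t(x_i)t^{2i}+\sum_{i<j}\mu_t(x_i,x_j)t^{i+j}$. Equivalently, for all $x,y,z\in\mathfrak{g}$, $a\in\mathbb{F}$: $\mu_t(x,\mu_t(y,z))+\mu_t(y,\mu_t(z,x))+\mu_t(z,\mu_t(x,y))=0$; $\mu_t(\sigma_t(x),y)+\mu_t(x,\mu_t(x,y))=0$; $\sigma_t(ax)=a^2\sigma_t(x)$; $\sigma_t(x+y)=\sigma_t(x)+\sigma_t(y)+\mu_t(x,y)$; $\mathscr{D}_t(\mu_t(x,y))=\mu_t(\mathscr{D}_t(x),y)+\mu_t(x,\mathscr{D}_t(y))$; $\mathscr{D}_t(\sigma_t(x))=\mu_t(x,\mathscr{D}_t(x))$. The infinitesimal of the deformation is $((\mu_1,\sigma_1),\mathscr{D}_1)$ (it is a 2-cocycle). Equivalence: two deformations $((\tilde\mu_t,\tilde\sigma_t),\tilde{\mathscr{D}}_t)$ and $((\mu_t,\sigma_t),\mathscr{D}_t)$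 are equivalent if there is a formal isomorphism $\pi_t=\sum_{i\ge0}\pi_it^i:\mathfrak{g}[[t]]\to\mathfrak{g}[[t]]$ ($\mathbb{F}[[t]]$-linear), $\pi_i:\mathfrak{g}\to\mathfrak{g}$ linear, $\pi_0=\mathrm{Id}$, such that for all $x,y\in\mathfrak{g}$: $\pi_t(\tilde\mu_t(x,y))=\mu_t(\pi_t(x),\pi_t(y))$, $\pi_t(\tilde\sigma_t(x))=\sigma_t(\pi_t(x))$, $\pi_t(\tilde{\mathscr{D}}_t(x))=\mathscr{D}_t(\pi_t(x))$. Cohomology (adjoint coefficients): $C^2_{\mathrm{ResLD}}(\mathfrak{g};\mathfrak{g})$ is the set of $((\varphi_2,\omega_2),\varphi_1)$ with $\varphi_2:\wedge^2\mathfrak{g}\to\mathfrak{g}$ alternating bilinear, $\omega_2:\mathfrak{g}\to\mathfrak{g}$ satisfying $\omega_2(ax)=a^2\omega_2(x)$, $\omega_2(x+y)=\omega_2(x)+\omega_2(y)+\varphi_2(x,y)$, and $\varphi_1:\mathfrak{g}\to\mathfrak{g}$ linear. $Z^2_{\mathrm{ResLD}}(\mathfrak{g};\mathfrak{g})$ is the subspace of those satisfying for all $x,y,z$: (i) the cyclic sum over $(x,y,z)$ of $[x,\varphi_2(y,z)]_{\mathfrak{g}}+\varphi_2([y,z]_{\mathfrak{g}},x)$ is $0$; (ii) $[x,\varphi_2(x,y)]_{\mathfrak{g}}+\varphi_2(x^{[2]},y)+\varphi_2([x,y]_{\mathfrak{g}},x)+[y,\omega_2(x)]_{\mathfrak{g}}=0$;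 (iii) $\varphi_1([x,y]_{\mathfrak{g}})+[x,\varphi_1(y)]_{\mathfrak{g}}+[y,\varphi_1(x)]_{\mathfrak{g}}+\varphi_2(\mathscr{D}(x),y)+\varphi_2(x,\mathscr{D}(y))+\mathscr{D}(\varphi_2(x,y))=0$; (iv) $\varphi_1(x^{[2]})+[x,\varphi_1(x)]_{\mathfrak{g}}+\mathscr{D}(\omega_2(x))+\varphi_2(x,\mathscr{D}(x))=0$. $B^2_{\mathrm{ResLD}}(\mathfrak{g};\mathfrak{g})$ is the set of $\vartheta^1\pi=((d^1\pi,\omega_\pi),\delta\pi)$, $\pi:\mathfrak{g}\to\mathfrak{g}$ linear, where $d^1\pi(x,y)=\pi([x,y]_{\mathfrak{g}})+[x,\pi(y)]_{\mathfrak{g}}+[y,\pi(x)]_{\mathfrak{g}}$, $\omega_\pi(x)=\pi(x^{[2]})+[x,\pi(x)]_{\mathfrak{g}}$, $\delta\pi(x)=\mathscr{D}(\pi(x))+\pi(\mathscr{D}(x))$. $H^2_{\mathrm{ResLD}}=Z^2_{\mathrm{ResLD}}/B^2_{\mathrm{ResLD}}$. *)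

(* Defs.v *)
From HB Require Import structures.
From mathcomp Require Import all_boot all_order all_algebra.
From mathcomp Require Import generic_quotient ring_quotient.
From mathcomp Require Import boolp functions.
Set Implicit Arguments.
Unset Strict Implicit.
Unset Printing Implicit Defensive.
Import GRing.Theory.
Local Open Scope ring_scope.
Local Open Scope quotient_scope.

Section ResLieDer.
Variables (R : comNzRingType) (g : lmodType R).
Implicit Types (br : g -> g -> g) (sq D : g -> g).

Record alt_bilinear (m : g -> g -> g) : Prop := AltBilinear {
  alt_linl : forall y, linear (m^~ y);
  alt_linr : forall x, linear (m x);
  alt_xx : forall x, m x x = 0 }.

(* Quadratic maps with polar form m: the condition imposed both on the
   restriction map (with m the bracket) and on the second component omega of a
   2-cochain (with m = phi). *)
Record quadratic_wrt (m : g -> g -> g) (q : g -> g) : Prop := QuadraticWrt {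
  quad_scale : forall a x, q (a *: x) = a ^+ 2 *: q x;
  quad_add : forall x y, q (x + y) = q x + q y + m x y }.

Record is_lie br : Prop := IsLie {
  lie_alt : alt_bilinear br;
  lie_jacobi : forall x y z,
    br x (br y z) + br y (br z x) + br z (br x y) = 0 }.

Record is_restricted_lie br sq : Prop := IsRestrictedLie {
  rlie_lie : is_lie br;
  rlie_sq : forall x y, br (sq x) y = br x (br x y);
  rlie_quad : quadratic_wrt br sq }.

Record is_resLieDer br sq D : Prop := IsResLieDer {
  rld_rlie : is_restricted_lie br sq;
  rld_linear : linear D;
  rld_leibniz : forall x y, D (br x y) = br (D x) y + br x (D y);
  rld_sq : forall x, D (sq x) = br x (D x) }.

Record resLieDer := ResLieDer {
  br : g -> g -> g;
  sq : g -> g;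
  der : g -> g;
  resLieDerP : is_resLieDer br sq der }.

End ResLieDer.

(* V[[t]], as the sequences of coefficients.  The ring structure on F[[t]] and
   the F[[t]]-module structure on g[[t]] are the Cauchy products, not the
   pointwise ones carried by nat -> F and nat -> g. *)
Definition fps (V : Type) : Type := nat -> V.

HB.instance Definition _ (V : choiceType) := Choice.copy (fps V) (nat -> V).

Section FpsZmodule.
Variable V : zmodType.
Implicit Types x y z : fps V.

Definition fps_zero : fps V := fun=> 0.
Definition fps_opp x : fps V := fun n => - x n.
Definition fps_add x y : fps V := fun n => x n + y n.

Lemma fps_addA : associative fps_add.
Proof. by move=> x y z; apply/funext => n; exact: addrA. Qed.
Lemma fps_addC : commutative fps_add.
Proof. by move=> x y; apply/funext => n; exact: addrC. Qed.
Lemma fps_add0 : left_id fps_zero fps_add.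
Proof. by move=> x; apply/funext => n; exact: add0r. Qed.
Lemma fps_addN : left_inverse fps_zero fps_opp fps_add.
Proof. by move=> x; apply/funext => n; exact: addNr. Qed.

HB.instance Definition _ := GRing.isZmodule.Build (fps V)
  fps_addA fps_addC fps_add0 fps_addN.

Lemma fps_addE x y n : (x + y) n = x n + y n. Proof. by []. Qed.

End FpsZmodule.

Section FpsModule.
Variables (R : comNzRingType) (V : lmodType R).

Definition fpsC (x : V) : fps V := fun n => if n == 0 then x else 0.

Definition fps_scale (a : fps R) (x : fps V) : fps V :=
  fun n => \sum_(i < n.+1) a i *: x (n - i)%N.

Lemma fps_scaleDr a : {morph fps_scale a : x y / x + y}.
Proof.
move=> x y; apply/funext => n; rewrite /fps_scale fps_addE.
by rewrite -big_split; apply: eq_bigr => i _; rewrite fps_addE scalerDr.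
Qed.

Lemma fps_scaleDl x : {morph fps_scale^~ x : a b / a + b}.
Proof.
move=> a b; apply/funext => n; rewrite /fps_scale fps_addE.
by rewrite -big_split; apply: eq_bigr => i _; rewrite fps_addE scalerDl.
Qed.

End FpsModule.

Section FpsRing.
Variable R : comNzRingType.

Definition fps_mul (a b : fps R) : fps R :=
  fun n => \sum_(i < n.+1) a i * b (n - i)%N.

Lemma fps_scaleA (V : lmodType R) (a b : fps R) (x : fps V) :
  fps_scale a (fps_scale b x) = fps_scale (fps_mul a b) x.
Proof.
apply/funext => n; rewrite /fps_scale /fps_mul.
under eq_bigr => i _ do rewrite scaler_sumr.
under [RHS]eq_bigr => i _ do rewrite scaler_suml.
transitivity (\sum_(i < n.+1) \sum_(k < n.+1 | (i <= k)%N)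
   (a i * b (k - i)%N) *: x (n - k)%N).
  apply: eq_bigr => i _.
  rewrite -(big_mkord xpredT (fun j => a i *: (b j *: x (n - i - j)%N))).
  rewrite -(big_mkord (fun k => (i <= k)%N)
    (fun k => (a i * b (k - i)%N) *: x (n - k)%N)).
  rewrite [RHS](@big_cat_nat _ _ _ i) //=; last exact: ltnW (ltn_ord i).
  rewrite [X in _ = X + _]big_nat_cond [X in _ = X + _]big_pred0 ?add0r; last first.
    by move=> k /=; case: leqP; rewrite ?andbF.
  rewrite [RHS](@big_addn _ _ _ 0 n.+1 i) subSn; last by rewrite -ltnS ltn_ord.
  rewrite [LHS]big_nat [RHS]big_nat_cond; apply: eq_big => j /=.
    by rewrite leq_addl andbT.
  by move=> _; rewrite addnK scalerA subnDA subnAC.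
rewrite (exchange_big_dep xpredT) //=; apply: eq_bigr => k _.
rewrite -(big_mkord (fun i => (i <= k)%N)
  (fun i => (a i * b (k - i)%N) *: x (n - k)%N)).
rewrite -(big_mkord xpredT (fun i => (a i * b (k - i)%N) *: x (n - k)%N)).
rewrite [LHS](@big_cat_nat _ _ _ k.+1) //=.
rewrite [X in _ + X]big_nat_cond [X in _ + X]big_pred0 ?addr0; last first.
  by move=> i /=; case: (ltnP k i); rewrite ?andbF.
rewrite big_nat_cond [RHS]big_nat; apply: eq_bigl => i /=.
by rewrite ltnS andbb.
Qed.

Lemma fps_mulA : associative fps_mul.
Proof. exact: (@fps_scaleA R^o). Qed.

Lemma fps_mulC : commutative fps_mul.
Proof.
move=> a b; apply/funext => n; rewrite /fps_mul (reindex_inj rev_ord_inj) /=.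
apply: eq_bigr => i _; rewrite subSS mulrC subKn //; by rewrite -ltnS.
Qed.

Definition fps_one : fps R := fpsC (1 : R^o).

Lemma fps_scale1 (V : lmodType R) : left_id fps_one (@fps_scale R V).
Proof.
move=> x; apply/funext => n; rewrite /fps_scale big_ord_recl /= scale1r subn0.
by rewrite big1 ?addr0 // => i _; rewrite /fps_one /fpsC /= scale0r.
Qed.

Lemma fps_mul1 : left_id fps_one fps_mul.
Proof. exact: (@fps_scale1 R^o). Qed.

Lemma fps_mulDl : left_distributive fps_mul +%R.
Proof. by move=> a b x; exact: (@fps_scaleDl R R^o x a b). Qed.

Lemma fps_one_neq0 : fps_one != 0.
Proof. by apply/eqP => /(congr1 (@^~ 0)) /eqP; rewrite (negbTE (oner_neq0 _)). Qed.

HB.instance Definition _ := GRing.Zmodule_isComNzRing.Build (fps R)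
  fps_mulA fps_mulC fps_mul1 fps_mulDl fps_one_neq0.

HB.instance Definition _ (V : lmodType R) :=
  GRing.Zmodule_isLmodule.Build (fps R) (fps V)
    (@fps_scaleA V) (@fps_scale1 V) (@fps_scaleDr R V) (@fps_scaleDl R V).

End FpsRing.

Section Extension.
Variables (F : fieldType) (g : lmodType F).

(* The extensions to g[[t]] of f_t = sum_i f_i t^i, for f_i linear, bilinear,
   and (for sigma_t, relative to mu_t) quadratic. *)
Definition ext_lin (f : nat -> g -> g) (x : fps g) : fps g :=
  fun n => \sum_(k < n.+1) f k (x (n - k)%N).

Definition ext_bilin (m : nat -> g -> g -> g) (x y : fps g) : fps g :=
  fun n => \sum_(k < n.+1) \sum_(i < (n - k).+1) m k (x i) (y (n - k - i)%N).

Definition ext_quad (m : nat -> g -> g -> g) (s : nat -> g -> g) (x : fps g) :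
    fps g :=
  fun n => \sum_(k < n.+1) \sum_(i < n.+1 | (k + 2 * i == n)%N) s k (x i)
    + \sum_(k < n.+1) \sum_(i < n.+1)
        \sum_(j < n.+1 | (i < j)%N && (k + i + j == n)%N) m k (x i) (x j).

Record deformation (L : resLieDer g) := Deformation {
  mu_ : nat -> g -> g -> g;
  sigma_ : nat -> g -> g;
  der_ : nat -> g -> g;
  mu_alt : forall i, alt_bilinear (mu_ i);
  der_linear : forall i, linear (der_ i);
  mu_0 : mu_ 0 =2 br L;
  sigma_0 : sigma_ 0 =1 sq L;
  der_0 : der_ 0 =1 der L;
  deformationP : @is_resLieDer (fps F) (fps g)
    (ext_bilin mu_) (ext_quad mu_ sigma_) (ext_lin der_) }.

Definition mu_t (L : resLieDer g) (d : deformation L) := ext_bilin (mu_ d).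
Definition sigma_t (L : resLieDer g) (d : deformation L) :=
  ext_quad (mu_ d) (sigma_ d).
Definition der_t (L : resLieDer g) (d : deformation L) := ext_lin (der_ d).

(* No invertibility clause is needed: p 0 = id makes ext_lin p bijective. *)
Definition equivalent_deformations (L : resLieDer g) (d' d : deformation L) :
    Prop :=
  exists p : nat -> {linear g -> g},
    let p_t := ext_lin (fun i => p i) in
    [/\ p 0 =1 id,
        forall x y : g, p_t (mu_t d' (fpsC x) (fpsC y))
                        = mu_t d (p_t (fpsC x)) (p_t (fpsC y)),
        forall x : g, p_t (sigma_t d' (fpsC x)) = sigma_t d (p_t (fpsC x)) &
        forall x : g, p_t (der_t d' (fpsC x)) = der_t d (p_t (fpsC x))].

End Extension.

Section Cohomology.
Variables (F : fieldType) (g : lmodType F) (L : resLieDer g).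

Local Notation "[ x , y ]" := (br L x y) (at level 0).
Local Notation "x ^[2]" := (sq L x) (at level 2, format "x ^[2]").
Local Notation D := (der L).

(* Triples ((phi2, omega2), phi1), with the pointwise F-module structure. *)
Definition precochain2 : Type := ((g -> g -> g) * (g -> g)) * (g -> g).
HB.instance Definition _ := GRing.Lmodule.on precochain2.

Record in_C2 (c : precochain2) : Prop := InC2 {
  C2_alt : alt_bilinear c.1.1;
  C2_quad : quadratic_wrt c.1.1 c.1.2;
  C2_linear : linear c.2 }.

Record in_Z2 (c : precochain2) : Prop := InZ2 {
  Z2_C2 : in_C2 c;
  Z2_jacobi : forall x y z,
    ([x, c.1.1 y z] + c.1.1 [y, z] x)
    + ([y, c.1.1 z x] + c.1.1 [z, x] y)
    + ([z, c.1.1 x y] + c.1.1 [x, y] z) = 0;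
  Z2_sq : forall x y,
    [x, c.1.1 x y] + c.1.1 x^[2] y + c.1.1 [x, y] x + [y, c.1.2 x] = 0;
  Z2_leibniz : forall x y,
    c.2 [x, y] + [x, c.2 y] + [y, c.2 x]
    + c.1.1 (D x) y + c.1.1 x (D y) + D (c.1.1 x y) = 0;
  Z2_der_sq : forall x,
    c.2 x^[2] + [x, c.2 x] + D (c.1.2 x) + c.1.1 x (D x) = 0 }.

Definition coboundary (p : g -> g) : precochain2 :=
  ((fun x y => p [x, y] + [x, p y] + [y, p x],
    fun x => p x^[2] + [x, p x]),
    fun x => D (p x) + p (D x)).

Definition Z2_pred : {pred precochain2} := [pred c | `[< in_Z2 c >]].

Lemma Z2P c : reflect (in_Z2 c) (c \in Z2_pred).
Proof. exact: asboolP. Qed.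

(* Every defining equation of Z2 has the form f c = h c with f and h linear
   in c. *)
Let lin (f : precochain2 -> g) := forall a u v, f (a *: u + v) = a *: f u + f v.

Let lin0 : lin (fun=> 0).
Proof. by move=> a u v; rewrite scaler0 addr0. Qed.
Let linD f h : lin f -> lin h -> lin (fun c => f c + h c).
Proof. by move=> lf lh a u v; rewrite lf lh scalerDr addrACA. Qed.
Let linZ b f : lin f -> lin (fun c => b *: f c).
Proof. by move=> lf a u v; rewrite lf scalerDr !scalerA mulrC. Qed.
Let linbr x f : lin f -> lin (fun c => [x, f c]).
Proof.
move=> lf a u v; rewrite lf; exact: alt_linr (lie_alt (rlie_lie (rld_rlie
  (resLieDerP L)))) _ _ _ _.
Qed.
Let lind f : lin f -> lin (fun c => D (f c)).
Proof. by move=> lf a u v; rewrite lf; exact: rld_linear (resLieDerP L) _ _ _. Qed.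
Let linm x y : lin (fun c => c.1.1 x y). Proof. by []. Qed.
Let linq x : lin (fun c => c.1.2 x). Proof. by []. Qed.
Let linp x : lin (fun c => c.2 x). Proof. by []. Qed.

Let lin_eq f h : lin f -> lin h -> forall a u v,
  f u = h u -> f v = h v -> f (a *: u + v) = h (a *: u + v).
Proof. by move=> lf lh a u v eu ev; rewrite lf lh eu ev. Qed.

Let lin_eq0 f h : lin f -> lin h -> f 0 = h 0.
Proof.
move=> lf lh; have := lf (-1) 0 0; have := lh (-1) 0 0.
by rewrite scaler0 addr0 !scaleN1r !addNr => -> ->.
Qed.

Ltac lin_tac := do ![exact: lin0 | exact: linm | exact: linq | exact: linp
  | apply: linD | apply: linZ | apply: linbr | apply: lind].

Lemma Z2_submod_closed : submod_closed Z2_pred.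
Proof.
split.
  have zP (f h : precochain2 -> g) : lin f -> lin h -> f 0 = h 0 by apply: lin_eq0.
  apply/Z2P; move: zP; set c : precochain2 := 0 => zP.
  by split; [split; [split | split |] | ..]; repeat (hnf; intro);
    pattern c;
    match goal with |- (fun z => @?f z = @?h z) _ => apply: (zP f h) end;
    lin_tac.
move=> a u v /Z2P uZ /Z2P vZ; apply/Z2P.
have zP (f h : precochain2 -> g) : lin f -> lin h -> f u = h u -> f v = h v ->
  f (a *: u + v) = h (a *: u + v) by move=> *; apply: lin_eq.
move: zP; set c : precochain2 := a *: u + v => zP.
case: uZ => [[[u1 u2 u3] [u4 u5] u6] u7 u8 u9 u10].
case: vZ => [[[v1 v2 v3] [v4 v5] v6] v7 v8 v9 v10].
by split; [split; [split | split |] | ..]; repeat (hnf; intro);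
    pattern c;
    match goal with |- (fun z => @?f z = @?h z) _ => apply: (zP f h) end;
    first [by lin_tac | match goal with H : _ |- _ => exact: H end].
Qed.

HB.instance Definition _ := GRing.isSubmodClosed.Build F precochain2 Z2_pred
  Z2_submod_closed.

Definition Z2 : Type := {c | c \in Z2_pred}.

HB.instance Definition _ := SubChoice.on Z2.
HB.instance Definition _ := [SubChoice_isSubLmodule of Z2 by <:].

(* B2 as a subset of Z2; coboundary_in_Z2 below shows that every coboundary
   lies in Z2, so nothing is cut off. *)
Definition B2_pred : {pred Z2} :=
  [pred z | `[< exists p : {linear g -> g}, val z = coboundary p >]].

Lemma B2P z :
  reflect (exists p : {linear g -> g}, val z = coboundary p) (z \in B2_pred).
Proof. exact: asboolP. Qed.

Lemma B2_submod_closed : submod_closed B2_pred.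
Proof.
have AB := lie_alt (rlie_lie (rld_rlie (resLieDerP L))).
have brx0 x : [x, 0] = 0.
  have := alt_linr AB x (-1) 0 0; by rewrite scaler0 addr0 scaleN1r addNr.
have D0 : D 0 = 0.
  have := rld_linear (resLieDerP L) (-1) 0 0.
  by rewrite scaler0 addr0 scaleN1r addNr.
split.
  apply/B2P; exists (\0 : {linear g -> g}); congr (_, _, _).
  - by apply/funext => x; apply/funext => y; rewrite /= !brx0 !addr0.
  - by apply/funext => x; rewrite /= brx0 addr0.
  - by apply/funext => x; rewrite /= D0 addr0.
move=> a z z' /B2P[p pE] /B2P[q qE]; apply/B2P; exists (a \*: p \+ q).
have -> : val (a *: z + z') = a *: coboundary p + coboundary q.
  by rewrite -pE -qE.
congr (_, _, _).
- apply/funext => x; apply/funext => y; rewrite !(alt_linr AB).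
  rewrite -[LHS]/(a *: (p [x, y] + [x, p y] + [y, p x])
                  + (q [x, y] + [x, q y] + [y, q x])).
  by rewrite !scalerDr addrACA [X in X + _ = _]addrACA.
- apply/funext => x; rewrite (alt_linr AB).
  rewrite -[LHS]/(a *: (p x^[2] + [x, p x]) + (q x^[2] + [x, q x])).
  by rewrite scalerDr addrACA.
- apply/funext => x; rewrite (rld_linear (resLieDerP L)).
  rewrite -[LHS]/(a *: (D (p x) + p (D x)) + (D (q x) + q (D x))).
  by rewrite scalerDr addrACA.
Qed.

HB.instance Definition _ := GRing.isSubmodClosed.Build F Z2 B2_pred
  B2_submod_closed.

Definition H2 : Type := Quotient.quot B2_pred.
HB.instance Definition _ := GRing.Zmodule.on H2.
HB.instance Definition _ := EqQuotient.on H2.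

Definition H2_scale (a : F) : H2 -> H2 := fun h => \pi_H2 (a *: repr h).

Let pi_scale a z : H2_scale a (\pi_H2 z) = \pi_H2 (a *: z).
Proof.
apply/eqP; rewrite /H2_scale -Quotient.idealrBE -scalerBr rpredZ //.
by rewrite Quotient.idealrBE reprK.
Qed.

Let H2_scaleA a b v : H2_scale a (H2_scale b v) = H2_scale (a * b) v.
Proof. by rewrite [H2_scale b v]/H2_scale pi_scale scalerA. Qed.
Let H2_scale1 : left_id 1 H2_scale.
Proof. by move=> v; rewrite -[v]reprK pi_scale scale1r. Qed.
Let H2_scaleDr : right_distributive H2_scale +%R.
Proof.
move=> a v w; rewrite -[v]reprK -[w]reprK -(raddfD (\pi_(Quotient.quot B2_pred))).
by rewrite !pi_scale scalerDr raddfD.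
Qed.
Let H2_scaleDl v : {morph H2_scale^~ v : a b / a + b}.
Proof. by move=> a b; rewrite -[v]reprK !pi_scale scalerDl raddfD. Qed.

HB.instance Definition _ := GRing.Zmodule_isLmodule.Build F H2
  H2_scaleA H2_scale1 H2_scaleDr H2_scaleDl.

Section Coboundary.
Hypothesis char2 : 2 \in [pchar F].

Let AB : alt_bilinear (br L).
Proof. exact: lie_alt (rlie_lie (rld_rlie (resLieDerP L))). Qed.
Let xx (x : g) : x + x = 0.
Proof. by rewrite -mulr2n -scaler_nat pcharf0 // scale0r. Qed.
Let xxy (x y : g) : x + (x + y) = y.
Proof. by rewrite addrA xx add0r. Qed.
Let oppx (x : g) : - x = x.
Proof. by apply/eqP; rewrite eq_sym -addr_eq0 xx. Qed.
Let brDr x y z : [x, y + z] = [x, y] + [x, z].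
Proof. by have := alt_linr AB x 1 y z; rewrite !scale1r. Qed.
Let brDl x y z : [y + z, x] = [y, x] + [z, x].
Proof. by have := alt_linl AB x 1 y z; rewrite !scale1r. Qed.
Let brC x y : [x, y] = [y, x].
Proof.
have /eqP := alt_xx AB (x + y).
by rewrite brDr !brDl !(alt_xx AB) add0r addr0 addr_eq0 oppx => /eqP.
Qed.
Let jac x y z : [x, [y, z]] = [y, [z, x]] + [z, [x, y]].
Proof.
have /eqP := lie_jacobi (rlie_lie (rld_rlie (resLieDerP L))) x y z.
by rewrite -addrA addr_eq0 oppx => /eqP.
Qed.
Let DD x y : D (x + y) = D x + D y.
Proof. by have := rld_linear (resLieDerP L) 1 x y; rewrite !scale1r. Qed.

Let DZ a x : D (a *: x) = a *: D x.
Proof.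
have D0 : D 0 = 0 by apply: (addrI (D 0)); rewrite -DD !addr0.
by have := rld_linear (resLieDerP L) a x 0; rewrite !addr0 D0 addr0.
Qed.
Let brZr a x y : [x, a *: y] = a *: [x, y].
Proof.
have b0 : [x, 0] = 0 by apply: (addrI [x, 0]); rewrite -brDr !addr0.
by have := alt_linr AB x a y 0; rewrite !addr0 b0 addr0.
Qed.
Let brZl a x y : [a *: x, y] = a *: [x, y].
Proof. by rewrite brC brZr brC. Qed.
Let brsq x y : [x^[2], y] = [x, [x, y]].
Proof. exact: rlie_sq (rld_rlie (resLieDerP L)) _ _. Qed.
Let Dbr x y : D [x, y] = [D x, y] + [x, D y].
Proof. exact: rld_leibniz (resLieDerP L) _ _. Qed.
Let Dsq x : D (x^[2]) = [x, D x].
Proof. exact: rld_sq (resLieDerP L) _. Qed.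
Let sqP := rlie_quad (rld_rlie (resLieDerP L)).
Let eq2 (x y : g) : x + y = 0 -> x = y.
Proof. by move=> /eqP; rewrite addr_eq0 oppx => /eqP. Qed.

Ltac cancel2 := rewrite -?addrA ?addr0; repeat first [done | rewrite xx; done |
  match goal with |- @eq _ ?l _ => match l with @GRing.add _ ?x _ =>
    first [rewrite (xxy x) | rewrite (addrCA _ x) | rewrite (addrC _ x)]
  end end].

Lemma coboundary_in_Z2 (p : {linear g -> g}) : in_Z2 (coboundary p).
Proof.
have pD x y : p (x + y) = p x + p y by exact: raddfD.
have pZ a x : p (a *: x) = a *: p x by exact: linearZ.
have p0 : p 0 = 0 by exact: raddf0.
split; first (split; [split | split |]); rewrite /coboundary /=.
- move=> z a x y; apply: eq2.
  by rewrite !(pD, pZ, brDl, brDr, brZl, brZr, scalerDr); cancel2.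
- move=> z a x y; apply: eq2.
  by rewrite !(pD, pZ, brDl, brDr, brZl, brZr, scalerDr); cancel2.
- by move=> x; rewrite (alt_xx AB) p0 add0r xx.
- move=> a x; rewrite (quad_scale sqP) pZ pZ brZl brZr scalerDr.
  by rewrite scalerA expr2.
- move=> x y; rewrite (quad_add sqP) !pD !(brDl, brDr); by apply: eq2; cancel2.
- move=> a x y; apply: eq2; by rewrite !(pD, pZ, DD, DZ, scalerDr);
    cancel2.
- move=> x y z.
  rewrite (brC [y, z] x) (brC [z, x] y) (brC [x, y] z).
  rewrite (brC [y, z] (p x)) (brC [z, x] (p y)) (brC [x, y] (p z)).
  rewrite (jac x y z) (jac (p x)) (jac (p y)) (jac (p z)) !brDr !pD.
  by rewrite (brC (p x) y) (brC (p y) z) (brC (p z) x); cancel2.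
- move=> x y; rewrite !brsq (brC [x, y] x) (brC [x, y] (p x)) (jac (p x)).
  by rewrite (brC (p x) x) !brDr; cancel2.
- by move=> x y; rewrite !(DD, Dbr, brDr, pD); cancel2.
- by move=> x; rewrite !(DD, Dbr, Dsq, brDr, pD); cancel2.
Qed.

End Coboundary.

Definition infinitesimal (d : deformation L) : precochain2 :=
  ((mu_ d 1, sigma_ d 1), der_ d 1).

End Cohomology.

(* Main.v *)
Require Import Defs.
From mathcomp Require Import all_boot all_order all_algebra.
From mathcomp Require Import generic_quotient.
From mathcomp Require Import ring_quotient boolp.
Set Implicit Arguments.
Unset Strict Implicit.
Unset Printing Implicit Defensive.
Import GRing.Theory.
Local Open Scope ring_scope.
Local Open Scope quotient_scope.

(** Every identity defining a deformation, and every identity defining an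
    equivalence, is evaluated at constant series and read off modulo [t^2].
    For the deformation identities, the coefficient of [t] is, up to signs and
    the symmetry of alternating maps, both harmless in characteristic 2, the
    corresponding 2-cochain or 2-cocycle condition on
    [((mu_1, sigma_1), D_1)]; hence [infinitesimal_in_C2] and
    [infinitesimal_in_Z2].  For the equivalence [p_t = id + p_1 t + ...], the
    coefficient of [t] says that the two infinitesimals differ by
    [coboundary p_1] ([infinitesimal_sub]).  Both steps rest on the formulas
    for the coefficients of [1] and [t] of the extensions of linear, bilinear
    and quadratic maps to [g[[t]]]. *)

(** * Alternating bilinear maps and characteristic 2 *)

Section AltBilinear.
Variables (R : comNzRingType) (g : lmodType R) (m : g -> g -> g).
Hypothesis m_alt : alt_bilinear m.

Lemma alt_bilinear0r x : m x 0 = 0.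
Proof. by have := alt_linr m_alt x (-1) 0 0; rewrite scaler0 addr0 scaleN1r addNr. Qed.

Lemma alt_bilinear0l x : m 0 x = 0.
Proof. by have := alt_linl m_alt x (-1) 0 0; rewrite scaler0 addr0 scaleN1r addNr. Qed.

Lemma alt_bilinear_antisym x y : m x y = - m y x.
Proof.
have mDl u v w : m (u + v) w = m u w + m v w.
  by have := alt_linl m_alt w 1 u v; rewrite !scale1r.
have mDr u v w : m w (u + v) = m w u + m w v.
  by have := alt_linr m_alt w 1 u v; rewrite !scale1r.
have /eqP := alt_xx m_alt (x + y).
by rewrite mDr !mDl !(alt_xx m_alt) add0r addr0 addrC addr_eq0 => /eqP.
Qed.

End AltBilinear.

Section CharTwo.
Variables (F : fieldType) (g : lmodType F).
Hypothesis char2 : 2%N \in [pchar F].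

Lemma oppr_lmod_char2 (x : g) : - x = x.
Proof. by rewrite -scaleN1r oppr_pchar2 // scale1r. Qed.

Lemma addrr_lmod_char2 (x : g) : x + x = 0.
Proof. by rewrite -{1}[x]oppr_lmod_char2 addNr. Qed.

Lemma alt_bilinear_sym_char2 (m : g -> g -> g) (m_alt : alt_bilinear m) x y :
  m x y = m y x.
Proof. by rewrite (alt_bilinear_antisym m_alt) oppr_lmod_char2. Qed.

End CharTwo.

(** * Coefficients of 1 and t *)

Lemma fps_scale_coef0 (R : comNzRingType) (V : lmodType R) (a : fps R)
  (x : fps V) : (a *: x) 0%N = a 0%N *: x 0%N.
Proof. by rewrite [LHS]big_ord_recl big_ord0 addr0. Qed.

Lemma fps_scale_coef1 (R : comNzRingType) (V : lmodType R) (a : fps R)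
  (x : fps V) : (a *: x) 1%N = a 0%N *: x 1%N + a 1%N *: x 0%N.
Proof. by rewrite [LHS]big_ord_recl big_ord_recl big_ord0 addr0. Qed.

Section Coefficients.
Variables (F : fieldType) (g : lmodType F).
Implicit Types (f s : nat -> g -> g) (m : nat -> g -> g -> g) (x y : fps g).

Lemma ext_lin_coef0 f x : ext_lin f x 0%N = f 0%N (x 0%N).
Proof. by rewrite /ext_lin big_ord_recl big_ord0 addr0. Qed.

Lemma ext_lin_coef1 f x : ext_lin f x 1%N = f 0%N (x 1%N) + f 1%N (x 0%N).
Proof. by rewrite /ext_lin !big_ord_recl big_ord0 addr0. Qed.

Lemma ext_bilin_coef0 m x y : ext_bilin m x y 0%N = m 0%N (x 0%N) (y 0%N).
Proof. by rewrite /ext_bilin !big_ord_recl !big_ord0 !addr0. Qed.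

Lemma ext_bilin_coef1 m x y :
  ext_bilin m x y 1%N
  = m 0%N (x 0%N) (y 1%N) + m 0%N (x 1%N) (y 0%N) + m 1%N (x 0%N) (y 0%N).
Proof.
rewrite /ext_bilin !big_ord_recl !big_ord0 /=.
by rewrite !addr0 !subn0.
Qed.

Lemma ext_quad_coef0 m s x : ext_quad m s x 0%N = s 0%N (x 0%N).
Proof.
rewrite /ext_quad !big_ord_recl !big_ord0 /=.
do !rewrite [\sum_(j < 1 | _) _]big_mkcond !big_ord_recl big_ord0 /=.
by rewrite !(add0r, addr0).
Qed.

(** In degree 1 the sum over [i < j] leaves the cross term of [x_0] and
   [x_1 t]; the square of [x_1 t] only contributes from degree 2 on. *)
Lemma ext_quad_coef1 m s x :
  ext_quad m s x 1%N = s 1%N (x 0%N) + m 0%N (x 0%N) (x 1%N).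
Proof.
rewrite /ext_quad !big_ord_recl !big_ord0 /=.
do !rewrite [\sum_(j < 2 | _) _]big_mkcond !big_ord_recl big_ord0 /=.
by rewrite !(add0r, addr0).
Qed.

End Coefficients.

(** * Infinitesimals *)

Section Infinitesimal.
Variables (F : fieldType) (g : lmodType F) (L : resLieDer g).
Hypothesis char2 : 2%N \in [pchar F].

Let L_alt : alt_bilinear (br L).
Proof. exact: lie_alt (rlie_lie (rld_rlie (resLieDerP L))). Qed.
Let L_der0 : der L 0 = 0.
Proof.
have := rld_linear (resLieDerP L) (-1) 0 0.
by rewrite scaler0 addr0 scaleN1r addNr.
Qed.

Let brx0 x : br L x 0 = 0. Proof. exact: alt_bilinear0r. Qed.
Let br0x x : br L 0 x = 0. Proof. exact: alt_bilinear0l. Qed.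

Let coefE := (@ext_lin_coef0, @ext_lin_coef1, @ext_bilin_coef0,
  @ext_bilin_coef1, @ext_quad_coef0, @ext_quad_coef1, @fps_addE).
Let constE (V : lmodType F) (x : V) : (fpsC x 0%N = x) * (fpsC x 1%N = 0).
Proof. by []. Qed.

Section Cocycle.
Variable d : deformation L.

Let simpE := (coefE, constE, @mu_0 _ _ _ d, @sigma_0 _ _ _ d, @der_0 _ _ _ d,
  brx0, br0x, L_der0, add0r, addr0).

Lemma infinitesimal_in_C2 : in_C2 (infinitesimal d).
Proof.
have Q := rlie_quad (rld_rlie (deformationP d)).
split; [exact: mu_alt | split=> /= | exact: der_linear].
- move=> a x; have := congr1 (@^~ 1%N) (quad_scale Q (fpsC (a : F^o)) (fpsC x)).
  rewrite /= fps_scale_coef1 !coefE !(fps_scale_coef0, fps_scale_coef1).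
  (* The product of F[[t]] is its scaling action on F^o[[t]]. *)
  have a2_0 : ((fpsC (a : F^o) : fps F) ^+ 2) 0%N = a ^+ 2.
    exact: (@fps_scale_coef0 F F^o).
  have a2_1 : ((fpsC (a : F^o) : fps F) ^+ 2) 1%N = 0.
    apply: etrans (@fps_scale_coef1 F F^o _ _) _.
    by rewrite !constE scaler0 scale0r addr0.
  by rewrite a2_0 a2_1 !constE scaler0 !scale0r !simpE.
- move=> x y; have := congr1 (@^~ 1%N) (quad_add Q (fpsC x) (fpsC y)).
  by rewrite /= !simpE.
Qed.

Lemma infinitesimal_in_Z2 : in_Z2 L (infinitesimal d).
Proof.
have P := deformationP d.
have muC := alt_bilinear_sym_char2 char2 (mu_alt d 1).
have brC := alt_bilinear_sym_char2 char2 L_alt.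
have addr_eq (u v : g) : u = v -> u + v = 0.
  by move=> ->; exact: addrr_lmod_char2.
split=> /=; first exact: infinitesimal_in_C2.
- move=> x y z; have := congr1 (@^~ 1%N)
    (lie_jacobi (rlie_lie (rld_rlie P)) (fpsC x) (fpsC y) (fpsC z)).
  by rewrite /= !simpE !(muC (br L _ _)).
- move=> x y; have := congr1 (@^~ 1%N) (rlie_sq (rld_rlie P) (fpsC x) (fpsC y)).
  rewrite /= !simpE => /addr_eq <-.
  by rewrite (brC y) (muC (br L _ _)) [RHS](AC (2*2) (3*2*4*1)).
- move=> x y; have := congr1 (@^~ 1%N) (rld_leibniz P (fpsC x) (fpsC y)).
  rewrite /= !simpE => /addr_eq <-.
  by rewrite (brC y) [RHS](AC (2*(2*2)) (2*5*3*4*6*1)).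
- move=> x; have := congr1 (@^~ 1%N) (rld_sq P (fpsC x)).
  rewrite /= !simpE => /addr_eq <-.
  by rewrite [RHS](AC (2*2) (2*3*1*4)).
Qed.

End Cocycle.

(** The linear term of an equivalence realizes the difference of the
    infinitesimals as a coboundary. *)
Lemma infinitesimal_sub (d' d : deformation L) :
  equivalent_deformations d' d ->
  exists p : {linear g -> g},
    infinitesimal d' - infinitesimal d = coboundary L p.
Proof.
case=> p [p0 p_mu p_sigma p_der]; exists (p 1%N).
have brC := alt_bilinear_sym_char2 char2 L_alt.
have oppx := @oppr_lmod_char2 _ g char2.
have sub_eq (u v w z : g) : u + v = z + w -> u - w = v + z.
  by move=> /(canRL (addrK _)) ->; rewrite [- v]oppx addrAC addrK addrC.
congr (_, _, _).
- apply/funext => x; apply/funext => y.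
  have := congr1 (@^~ 1%N) (p_mu x y).
  rewrite /mu_t !coefE !constE !p0 !mu_0 !(brx0, br0x, add0r, addr0).
  by move=> /sub_eq eq_t; apply: etrans eq_t _; rewrite (brC y) addrA.
- apply/funext => x.
  have := congr1 (@^~ 1%N) (p_sigma x).
  rewrite /sigma_t !coefE !constE !p0 !sigma_0 !mu_0 !(brx0, add0r, addr0).
  by rewrite [X in _ = X]addrC => /sub_eq.
- apply/funext => x.
  have := congr1 (@^~ 1%N) (p_der x).
  rewrite /der_t !coefE !constE !p0 !der_0 L_der0 !add0r.
  by move=> /sub_eq eq_t; apply: etrans eq_t _; rewrite addrC.
Qed.

End Infinitesimal.

Theorem theorem4p6 (F : fieldType) (char2 : 2%N \in [pchar F]) (g : lmodType F)
    (L : resLieDer g) (d' d : deformation L)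
    (equiv : equivalent_deformations d' d) :
  exists z' z : Z2 L,
    [/\ val z' = infinitesimal d', val z = infinitesimal d
      & \pi_(H2 L) z' = \pi_(H2 L) z].
Proof.
have Z2d' : infinitesimal d' \in Z2_pred L by apply/Z2P/infinitesimal_in_Z2.
have Z2d : infinitesimal d \in Z2_pred L by apply/Z2P/infinitesimal_in_Z2.
pose toZ2 c (cZ : c \in Z2_pred L) : Z2 L := exist _ c cZ.
exists (toZ2 _ Z2d'), (toZ2 _ Z2d); split=> //.
apply/eqP; rewrite -Quotient.idealrBE; apply/B2P.
have [p pE] := infinitesimal_sub char2 equiv.
by exists p; rewrite -pE.
Qed.
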